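(* Let $T$ be a tree. The complement graph $\bar T$ of $T$ admits a convex outside-obstacle representation (OOR) if and only if $T$ is a caterpillar.
   Context: All graphs are finite and simple. The complement $\bar G$ of a graph $G$ has the same vertex set as $G$, and two distinct vertices are adjacent in $\bar G$ iff they are not adjacent in $G$. A caterpillar is a tree that contains a path such that all vertices are at distance at most $1$ from the path. A straight-line drawing $\Gamma$ of a graph $G$ maps the vertices to pairwise distinct points of $\mathbb{R}^2$ and each edge to the closed line segment between its endpoints. The outer face of $\Gamma$ is the unbounded connected component of the complement in $\mathbb{R}^2$ of the union of all vertex points and edge segments. A non-edge of $G$ is a pair of distinct non-adjacent vertices; it is identified with the line segment between its endpoints. An outside-obstacle representation (OOR) of $G$ is a straight-line drawing of $G$ such that no edge segment contains a vertex point other than its two endpoints and every non-edge segment intersects the outer face of the drawing. (Equivalently, $G$ is the visibility graph of the point set with respect to a single obstacle, namely the open outer face of the drawing.) An OOR is convex if the vertex points are in convex position, i.e., each vertex point is a corner of the convex hull of all vertex points. *)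

(* Defs.v *)
From HB Require Import structures.
From mathcomp Require Import all_boot all_order all_algebra.
From mathcomp Require Import all_classical all_reals all_analysis.

Set Implicit Arguments.
Unset Strict Implicit.
Unset Printing Implicit Defensive.

Import Order.TTheory GRing.Theory Num.Theory.
Import numFieldNormedType.Exports.

Local Open Scope classical_set_scope.
Local Open Scope ring_scope.

(* A finite simple graph is a symmetric irreflexive relation on a finType. *)
Definition compl_graph (V : finType) (e : rel V) : rel V :=
  fun u v => (u != v) && ~~ e u v.

(* For a symmetric relation, [:: x; y] is a ucycle as soon as e x y, so the
   cycles of the graph are the ucycles with at least three vertices. *)
Definition acyclic_graph (V : finType) (e : rel V) : Prop :=
  forall c : seq V, ucycle e c -> (size c <= 2)%N.

Definition is_tree (V : finType) (e : rel V) : Prop :=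
  [/\ (0 < #|V|)%N, forall u v : V, connect e u v & acyclic_graph e].

(* The graph distance between u and v is at most k. *)
Definition dist_le (V : finType) (e : rel V) (k : nat) (u v : V) : Prop :=
  exists p : seq V, [/\ path e u p, last u p = v & (size p <= k)%N].

Definition is_caterpillar (V : finType) (e : rel V) : Prop :=
  is_tree e /\
  exists (x : V) (p : seq V), [/\ path e x p, uniq (x :: p) &
    forall v : V, exists2 w : V, w \in x :: p & dist_le e 1 v w].

Section Plane.
Variable R : realType.
Implicit Types (x y : R * R) (A : set (R * R)).

Definition segment x y : set (R * R) :=
  [set (1 - t) *: x + t *: y | t in `[0, 1]%classic].

Definition conv_hull A : set (R * R) :=
  smallest (fun C : set (R * R) => convex_set C) A.

(* The corners of a convex polygon (possibly degenerated to a segment or a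
   point) are its extreme points. *)
Definition is_corner A x : Prop :=
  A x /\ forall y z (t : R), A y -> A z -> 0 < t < 1 ->
    x = (1 - t) *: y + t *: z -> y = x /\ z = x.

Variables (V : finType) (e : rel V) (pos : V -> R * R).

Definition drawing : set (R * R) :=
  range pos `|`
  [set x | exists u v : V, e u v /\ segment (pos u) (pos v) x].

(* The drawing is compact, so exactly one of the components of its complement
   is unbounded. *)
Definition outer_face : set (R * R) :=
  [set x | (~` drawing) x /\ ~ bounded_set (connected_component (~` drawing) x)].

Definition is_OOR : Prop :=
  [/\ injective pos,
      forall u v w : V, e u v -> segment (pos u) (pos v) (pos w) ->
        w = u \/ w = v &
      forall u v : V, u != v -> ~~ e u v ->
        segment (pos u) (pos v) `&` outer_face !=set0].

Definition convex_position : Prop :=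
  forall v : V, is_corner (conv_hull (range pos)) (pos v).

End Plane.

Definition has_convex_OOR (R : realType) (V : finType) (e : rel V) : Prop :=
  exists pos : V -> R * R, is_OOR e pos /\ convex_position pos.

(* Main.v *)
(* Forward direction: in convex position, consider an edge [a b] of the tree,
   that is, a non-edge of the drawing. If on each side of the line [a b] there
   are a vertex not adjacent to [a] and one not adjacent to [b], then complement
   edges enclose [a b] on both sides and no point of it sees the outer face. So on
   some side of [a b] all vertices are neighbours of [a], or all are neighbours of
   [b]. A tree that is not a caterpillar contains the spider with three legs of
   length two, and no circular order of its vertices has this property.

   Backward direction: put the vertices on the parabola [y = x^2], each spine
   vertex being followed by its leaves and then by the next spine vertex. For a
   tree edge [a b] with [a] on the left, every chord of the complement that starts
   at [a] and goes to the right ends beyond [b], so the vertical ray going down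
   from a point of [a b] close to [a] meets no edge. *)
Require Import Defs.
From mathcomp Require Import all_boot all_order all_algebra.
From mathcomp Require Import all_classical all_reals all_analysis.
From mathcomp Require Import zify ring lra.

Set Implicit Arguments.
Unset Strict Implicit.
Unset Printing Implicit Defensive.

Import Order.TTheory GRing.Theory Num.Theory.
Import numFieldNormedType.Exports.

Local Open Scope classical_set_scope.
Local Open Scope ring_scope.

(** * Segments and convex hulls *)

Section Convexity.
Variable R : realType.
Implicit Types (x y z : R * R).

Lemma segmentP x y z :
  segment x y z <-> exists t, [/\ 0 <= t <= 1,
    z.1 = (1 - t) * x.1 + t * y.1 & z.2 = (1 - t) * x.2 + t * y.2].
Proof.
split=> [[t /= t01 <-]|[t [t01 z1 z2]]]; exists t => //=.
by case: z z1 z2 => ? ? /= -> ->; case: x y => [? ?] [? ?].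
Qed.

Lemma segment_sym x y : segment x y `<=` segment y x.
Proof.
move=> z /segmentP[t [/andP[t0 t1] E1 E2]]; apply/segmentP.
by exists (1 - t); rewrite E1 E2; split; lra.
Qed.

Lemma convex_setP (A : set (R * R)) :
  @convex_set R (R * R)%type A <-> forall x y (t : R), A x -> A y -> 0 <= t <= 1 ->
    A ((1 - t) *: x + t *: y).
Proof.
split=> [cA x y t Ax Ay /andP[t0 t1]|cA x y l].
  have t01 : 0 <= 1 - t <= 1 by rewrite subr_ge0 t1 gerBl.
  have := cA x y (Itv01 (proj1 (andP t01)) (proj2 (andP t01))).
  rewrite !in_setE => /(_ Ax Ay).
  by rewrite /conv /= /unstable.onem subKr.
rewrite !in_setE => Ax Ay.
have := cA x y (1 - l%:inum) Ax Ay; rewrite subKr; apply.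
by rewrite subr_ge0 le1 gerBl ge0.
Qed.

Lemma conv_hull_convex (A : set (R * R)) x y (t : R) :
  conv_hull A x -> conv_hull A y -> 0 <= t <= 1 ->
  conv_hull A ((1 - t) *: x + t *: y).
Proof.
move=> Ax Ay t01 C [cC AC]; have/convex_setP := cC; apply=> //.
  exact: Ax.
exact: Ay.
Qed.

End Convexity.

(** * Trees and caterpillars *)

Section AcyclicGraphs.
Variables (V : finType) (e : rel V).
Hypotheses (e_sym : symmetric e) (e_irr : irreflexive e).
Hypothesis e_acyclic : acyclic_graph e.

Lemma acyclic_no_chord x p :
  path e x p -> uniq (x :: p) -> (1 < size p)%N -> ~~ e (last x p) x.
Proof.
move=> xp up sp; apply/negP => lx; have := e_acyclic (c := x :: p).
rewrite /ucycle /= rcons_path xp lx -/(uniq (x :: p)) up => /(_ isT) /=.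
by rewrite ltnNge in sp; rewrite ltnS (negbTE sp).
Qed.

Lemma acyclic_no_triangle u v w : e u v -> e v w -> ~~ e w u.
Proof.
move=> uv vw; case: (eqVneq u w) => [->|uw]; first by rewrite e_irr.
apply: (@acyclic_no_chord u [:: v; w]); rewrite //= ?uv ?vw //.
rewrite !inE negb_or uw !andbT /=; apply/andP; split.
  by apply: contraTneq uv => ->; rewrite e_irr.
by apply: contraTneq vw => ->; rewrite e_irr.
Qed.

Lemma acyclic_no_square u v w z :
  u != w -> v != z -> e u v -> e v w -> e w z -> ~~ e z u.
Proof.
move=> uw vz uv vw wz.
case: (eqVneq u z) => [->|uz]; first by rewrite e_irr.
apply: (@acyclic_no_chord u [:: v; w; z]); rewrite //= ?uv ?vw ?wz //.
have nz a b : e a b -> a != b by apply: contraTneq => ->; rewrite e_irr.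
by rewrite !inE !negb_or uw uz vz (nz _ _ uv) (nz _ _ vw) (nz _ _ wz).
Qed.

Section Spine.
Variables (x : V) (p : seq V).
Hypotheses (xp : path e x p) (up : uniq (x :: p)).
Let s := x :: p.

(** The slice of the spine between two of its vertices, in the form that [acyclic_no_chord] takes:
    closing it up by an edge or by a detour off the spine gives a cycle. *)
Lemma spine_interval w w' :
  w \in s -> w' \in s -> (index w s <= index w' s)%N ->
  exists q, [/\ path e w q, last w q = w', uniq (w :: q),
    {subset w :: q <= s} & size q = (index w' s - index w s)%N].
Proof.
move=> ws w's le_ww'; set i := index w s in le_ww' *; set j := index w' s in le_ww' *.
have lt_j : (j < size s)%N by rewrite index_mem.
pose c := drop i (take j.+1 s).
have sz_t : size (take j.+1 s) = j.+1 by rewrite size_takel.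
have sz_c : size c = (j.+1 - i)%N by rewrite size_drop sz_t.
have nth_c k : (k <= j - i)%N -> nth x c k = nth x s (i + k).
  by move=> k_le; rewrite nth_drop nth_take //; lia.
have srt : sorted e c by apply/drop_sorted/take_sorted; rewrite /s /= xp.
have uc : uniq c by rewrite drop_uniq // take_uniq.
have cs : {subset c <= s} by move=> y /mem_drop /mem_take.
case Ec: c => [|y q]; first by move: sz_c; rewrite Ec /=; lia.
have yw : y = w by have := nth_c 0%N isT; rewrite Ec addn0 /= nth_index.
subst y; exists q; rewrite -Ec; split=> //.
- by move: srt; rewrite Ec.
- have : last x c = w'.
    by rewrite -nth_last sz_c nth_c; [rewrite (_ : (i + _)%N = j) ?nth_index //; lia|lia].
  by rewrite Ec.
- by move: sz_c; rewrite Ec /=; lia.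
Qed.

(** Otherwise the edge would be a chord of the slice between its ends. *)
Lemma spine_index_succ w w' :
  w \in s -> w' \in s -> e w w' -> (index w s < index w' s)%N ->
  index w' s = (index w s).+1.
Proof.
move=> ws w's ww' lt_ww'.
have [q [wq lq uq _ sz]] := spine_interval ws w's (ltnW lt_ww').
have [sz1|] := leqP (size q) 1; first lia.
by move/(acyclic_no_chord wq uq); rewrite lq e_sym ww'.
Qed.

(** Two different neighbours would close the slice between them into a cycle through [v]. *)
Lemma spine_nbr_uniq v w w' :
  v \notin s -> w \in s -> w' \in s -> e v w -> e v w' -> w = w'.
Proof.
move=> vs; wlog le_ww' : w w' / (index w s <= index w' s)%N.
  move=> H ws w's vw vw'; case: (leqP (index w s) (index w' s)) => [|/ltnW] le.
    exact: H.
  by apply/esym/H.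
move=> ws w's vw vw'; have [q [wq lq uq qs _]] := spine_interval ws w's le_ww'.
case: q => [|y q] in wq lq uq qs *; first exact: lq.
have := @acyclic_no_chord v (w :: y :: q).
have -> : last v (w :: y :: q) = w' by [].
rewrite (e_sym w') vw' -[path e v _]/(e v w && path e w (y :: q)) vw wq.
have vwq : v \notin w :: y :: q by apply: contra vs => /qs.
by rewrite cons_uniq uq vwq => /(_ isT isT isT).
Qed.

(** Such an edge, together with the slice between the spine neighbours of its ends, would form a
    cycle; it has at least three vertices even if the slice is a single vertex. *)
Lemma off_spine_no_edge v v' :
  (forall u, u \notin s -> exists2 w, w \in s & e u w) ->
  v \notin s -> v' \notin s -> ~~ e v v'.
Proof.
move=> dom; have main u u' w w' : u \notin s -> u' \notin s -> w \in s ->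
    w' \in s -> e u w -> e u' w' -> (index w s <= index w' s)%N -> ~~ e u u'.
  move=> us u's ws w's uw u'w' le.
  case: (eqVneq u u') => [->|uu']; first by rewrite e_irr.
  have [q [wq lq uq qs _]] := spine_interval ws w's le.
  have := @acyclic_no_chord u (rcons (w :: q) u').
  rewrite last_rcons e_sym; apply.
  - rewrite rcons_path -[path e u _]/(e u w && path e w q) uw wq.
    by rewrite -[last u _]/(last w q) lq e_sym.
  - rewrite cons_uniq rcons_uniq mem_rcons in_cons negb_or uu' uq andbT /=.
    by apply/andP; split; [apply: contra us|apply: contra u's] => /qs.
  - by rewrite size_rcons.
move=> vs v's; have [w ws vw] := dom v vs; have [w' w's v'w'] := dom v' v's.
case: (leqP (index w s) (index w' s)) => [|/ltnW] le; first exact: (main _ _ w w').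
by rewrite e_sym; apply: (main _ _ w' w).
Qed.

End Spine.
End AcyclicGraphs.

(* Each spine vertex is followed by its leaves, then by the next spine vertex;
   so the neighbours of a spine vertex occupy the block right after it. *)
Lemma caterpillar_order (V : finType) (e : rel V) :
  symmetric e -> irreflexive e -> is_caterpillar e ->
  exists f : V -> nat, injective f /\
    forall a b c, e a b -> (f a < f c < f b)%N -> e a c.
Proof.
move=> e_sym e_irr [[_ _ ac] [x [p [xp up dom]]]].
pose s := x :: p.
have {}dom u : u \notin s -> exists2 w, w \in s & e u w.
  move=> us; have [w ws [q [uq lq sq]]] := dom u.
  case: q => [|y [|//]] /= in uq lq sq *; first by rewrite /s lq ws in us.
  by exists w => //; rewrite -lq; case/andP: uq.
(* The spine vertex that [v] hangs on; the default of [odflt] is never reached, by [dom]. *)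
pose att v := if v \in s then v else odflt v [pick w | (w \in s) && e v w].
have att_s v : att v \in s.
  rewrite /att; case: ifPn => // /dom[w ws vw].
  by case: pickP => [w' /andP[]//|/(_ w)]; rewrite ws vw.
have att_e v : v \notin s -> e v (att v).
  rewrite /att => vs; rewrite (negbTE vs); have [w ws vw] := dom v vs.
  by case: pickP => [w' /andP[]//|/(_ w)]; rewrite ws vw.
have att_id v : v \in s -> att v = v by rewrite /att => ->.
have att_uniq v w : v \notin s -> w \in s -> e v w -> att v = w.
  by move=> vs ws; apply: (spine_nbr_uniq e_sym ac xp up vs (att_s v) ws (att_e v vs)).
(* Since [r v < N], the number [i v * N + r v] encodes the lexicographic order of [(i v, r v)]; the
   value [r v = 0] puts a spine vertex before its leaves. *)
pose N := #|V|.+1.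
pose r v := if v \in s then 0%N else (enum_rank v).+1.
have rN v : (r v < N)%N by rewrite /r /N; case: ifP => // _; rewrite !ltnS ltn_ord.
pose i v := index (att v) s.
have i_inj u v : i u = i v -> att u = att v.
  by move=> E; rewrite -(nth_index x (att_s u)) -(nth_index x (att_s v)) -/(i u) E.
exists (fun v => i v * N + r v)%N; split.
  move=> u v /= E; have ru := rN u; have rv := rN v.
  have iE : i u = i v by case: (ltngtP (i u) (i v)) => // ?; exfalso; nia.
  have rE : r u = r v by rewrite iE in E; lia.
  move: rE; rewrite /r; case: ifPn => us; case: ifPn => vs //.
    by move=> _; rewrite -(att_id u us) -(att_id v vs); apply: i_inj.
  by move=> [] /val_inj/enum_rank_inj.
move=> a b c ab /andP[ac_lt cb_lt]; have ra := rN a; have rb := rN b; have rc := rN c.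
(* A leaf [a] has its spine vertex as only neighbour, and that one comes before it, unlike [b]. *)
have as_ : a \in s.
  apply: contraT => as_.
  case: (boolP (b \in s)) => bs; last first.
    by rewrite (negbTE (off_spine_no_edge e_sym e_irr ac xp up dom as_ bs)) in ab.
  have rb0 : r b = 0%N by rewrite /r bs.
  have : i a = i b by rewrite /i (att_uniq _ _ as_ bs ab) att_id.
  by rewrite rb0 in cb_lt *; nia.
have ra0 : r a = 0%N by rewrite /r as_.
(* [b] is either a leaf in the block of [a] or the first vertex of the next block, so [c] cannot
   have left the block of [a]. *)
have ic : i c = i a.
  have le_ac : (i a <= i c)%N by rewrite leqNgt; apply/negP => ?; nia.
  case: (boolP (b \in s)) => bs.
    have rb0 : r b = 0%N by rewrite /r bs.
    have lt_ab : (i a < i b)%N by rewrite ltnNge; apply/negP => ?; nia.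
    have E : i b = (i a).+1.
      rewrite /i !att_id // in lt_ab *.
      exact: (spine_index_succ e_sym ac xp up).
    by nia.
  have : i b = i a by rewrite /i (att_uniq b a) // ?att_id // e_sym.
  by nia.
have cs : c \notin s.
  by apply/negP => cs; move: ac_lt; rewrite ic /r cs as_ ltnn.
by rewrite e_sym; have := att_e c cs; rewrite (i_inj _ _ ic) att_id.
Qed.

Lemma crossing_edge (V : finType) (e : rel V) (D : pred V) (u v : V) :
  connect e u v -> D u -> ~~ D v -> exists a b, [/\ e a b, D a & ~~ D b].
Proof.
case/connectP=> q + ->; elim: q u => [|y q IH] u /=; first by move=> _ ->.
case/andP=> uy yq Du Dl; case: (boolP (D y)) => Dy; first exact: (IH y).
by exists u, y.
Qed.

(** If [s2] had at most one vertex, replacing [w :: s2] by [[:: w; u; v]] would give a longer path.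
    So [a] and [b] are the first two vertices of [s2]. *)
Lemma longest_path_extend (V : finType) (e : rel V) (s1 s2 : seq V) (w u v : V) :
  symmetric e -> irreflexive e ->
  sorted e (s1 ++ w :: s2) -> uniq (s1 ++ w :: s2) ->
  (forall s, sorted e s -> uniq s -> (size s <= size (s1 ++ w :: s2))%N) ->
  e w u -> e u v -> u \notin s1 ++ w :: s2 -> v \notin s1 ++ w :: s2 ->
  exists a b, [/\ e w a, e a b, a \in s2, b \in s2 & b != w].
Proof.
move=> e_sym e_irr srt un mx wu uv us vs.
have [sz|sz] := leqP (size s2) 1.
  have /mx : sorted e (s1 ++ [:: w; u; v]).
    move: srt; case: s1 {un mx us vs} => [|y s1] /=; first by rewrite wu uv.
    by rewrite !cat_path /= wu uv => /and3P[-> ->].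
  suff un' : uniq (s1 ++ [:: w; u; v]).
    by move/(_ un'); rewrite !size_cat /=; lia.
  have uv' : u != v by apply: contraTneq uv => ->; rewrite e_irr.
  move: un us vs; rewrite !(uniq_catC s1) !cat_cons cat0s !cons_uniq.
  rewrite !(mem_cat, in_cons) !negb_or cat_uniq uv'.
  case/andP=> /andP[_ ->] /and3P[_ _ ->] /and3P[-> uw _] /and3P[-> vw _].
  by rewrite (eq_sym w u) (eq_sym w v) uw vw.
case: s2 sz srt un {mx us vs} => [|a [|b s2]] // _.
rewrite sorted_cat_cons uniq_catC cat_cons cons_uniq mem_cat !in_cons !negb_or.
move=> /andP[_ /= /and3P[wa ab _]] /andP[/andP[/and3P[_ wb _] _] _].
by exists a, b; rewrite !in_cons !eqxx orbT /= eq_sym.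
Qed.

(** A longest path [s] does not dominate the tree, so some [w] on it has a neighbour [u] off it that
    continues to an undominated [v]. This is one leg; by maximality [s] runs at least two steps
    beyond [w] both ways, which gives the other two. *)
Lemma spider_of_not_caterpillar (V : finType) (e : rel V) :
  symmetric e -> irreflexive e -> is_tree e -> ~ is_caterpillar e ->
  exists o x1 y1 x2 y2 x3 y3,
    [/\ [/\ e o x1, e x1 y1 & y1 != o], [/\ e o x2, e x2 y2 & y2 != o],
        [/\ e o x3, e x3 y3 & y3 != o] & uniq [:: x1; x2; x3]].
Proof.
move=> e_sym e_irr tree ncat; have [/card_gt0P[v0 _] conn ac] := tree.
pose P n := `[< exists s, [/\ sorted e s, uniq s & size s = n] >].
have exP : exists n, P n by exists 1%N; apply/asboolP; exists [:: v0].
have ubP n : P n -> (n <= #|V|)%N.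
  by case/asboolP=> s [_ us <-]; rewrite -(card_uniqP us) max_card.
case: (ex_maxnP exP ubP) => n /asboolP[s [srt un sz]] mxn.
have {mxn}mx s' : sorted e s' -> uniq s' -> (size s' <= size s)%N.
  by move=> ss us; rewrite sz; apply: mxn; apply/asboolP; exists s'.
have [x [p Es]] : exists x p, s = x :: p.
  by case: s mx {srt un sz} => [/(_ [:: v0] isT isT)//|x p _]; exists x, p.
pose D v := (v \in s) || [exists w, (w \in s) && e v w].
have [v Dv] : exists v, ~~ D v.
  apply: contra_notP ncat => nD; split=> //; exists x, p.
  split; rewrite -?Es //; first by move: srt; rewrite Es.
  move=> v; have : D v by apply/negPn/negP => Dv; apply: nD; exists v.
  case/orP=> [vs|/existsP[w /andP[ws vw]]].
    by exists v => //; exists [::].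
  by exists w => //; exists [:: w]; rewrite /= vw.
have Dx : D x by rewrite /D Es mem_head.
have [u [{}v [uv Du {}Dv]]] := crossing_edge (conn x v) Dx Dv.
move: Dv; rewrite /D negb_or => /andP[vs /existsPn Dv].
have us : u \notin s by apply/negP => us; have := Dv u; rewrite us e_sym uv.
move: Du; rewrite /D (negbTE us) => /existsP[w /andP[ws uw]].
have wu : e w u by rewrite e_sym.
have vw : v != w by apply: contraNneq vs => ->.
case/splitPr: ws => s1 s2 in srt un sz mx us vs *.
have [a [b [wa ab as2 bs2 bw]]] :=
  longest_path_extend e_sym e_irr srt un mx wu uv us vs.
(* The third leg comes from the same lemma applied to the reversed path. *)
have [a' [b' [wa' ab' as1 bs1 bw']]] : exists a b,
    [/\ e w a, e a b, a \in s1, b \in s1 & b != w].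
  have Er : rev s2 ++ w :: rev s1 = rev (s1 ++ w :: s2).
    by rewrite rev_cat rev_cons cat_rcons.
  have [|||||||a' [b' []]] := @longest_path_extend V e (rev s2) (rev s1) w u v e_sym e_irr.
  - by rewrite Er rev_sorted (eq_sorted (e' := e)) // => y z; rewrite e_sym.
  - by rewrite Er rev_uniq.
  - by rewrite Er size_rev.
  - by [].
  - by [].
  - by rewrite Er mem_rev.
  - by rewrite Er mem_rev.
  by rewrite !mem_rev; exists a', b'.
exists w, u, v, a, b, a', b'; split=> //.
move: us un; rewrite mem_cat in_cons uniq_catC cat_cons cons_uniq cat_uniq !negb_or.
move=> /and3P[us1 _ us2] /andP[_ /and3P[_ /hasPn H _]].
rewrite !cons_uniq !in_cons !in_nil !orbF !negb_or.
rewrite !andbT -andbA; apply/and3P; split.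
- by apply: contraNneq us2 => ->.
- by apply: contraNneq us1 => ->.
- by apply: contraTneq as2 => ->; apply: H.
Qed.

(** * Drawing on a parabola *)

Section Parabola.
Variable R : realType.

Lemma vertical_ray_unbounded (A : set (R * R)) (a b : R) :
  (forall r, r <= b -> A (a, r)) -> ~ bounded_set A.
Proof.
move=> rayA.
have A_filter : ProperFilter (globally A) by apply: (globally_properfilter (rayA b _)).
move=> /ex_bound [M /= AM].
pose r := Num.min b (- `|M| - 1).
have /AM : A (a, r) by apply: rayA; rewrite ge_min lexx.
rewrite prod_normE /= ge_max => /andP[_]; apply/negP; rewrite -ltNge.
have r_le : r <= - `|M| - 1 by rewrite ge_min lexx orbT.
have : M <= `|M| by exact: ler_norm.
have : - r <= `|r| by rewrite -normrN ler_norm.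
lra.
Qed.

Lemma vertical_ray_connected (a b : R) :
  connected [set p : R * R | p.1 = a /\ p.2 <= b].
Proof.
have -> : [set p : R * R | p.1 = a /\ p.2 <= b] = (fun r => (a, r)) @` `]-oo, b]%classic.
  apply/seteqP; split=> [[p1 p2] /= [-> pb]|_ [r /= + <-]].
    by exists p2 => //=; rewrite in_itv.
  by rewrite in_itv.
apply: connected_continuous_connected.
  by apply/connected_intervalP; exact: (@interval_is_interval _ `]-oo, b]).
apply: continuous_subspaceT => r.
apply: (@cvg_pair _ _ _ _ (nbhs a) (nbhs r) _ _ _ (fun=> a) id).
  exact: cvg_cst.
exact: cvg_id.
Qed.

Variables (V : finType) (e : rel V) (f : V -> nat).
Hypotheses (e_sym : symmetric e) (e_irr : irreflexive e) (f_inj : injective f).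
Hypothesis f_block : forall a b c, e a b -> (f a < f c < f b)%N -> e a c.

Let pos v : R * R := ((f v)%:R, (f v)%:R ^+ 2).

(** The hull stays in the convex region above the parabola, and the height over the parabola of a
    convex combination is a sum of three nonnegative terms. At a point of the parabola all three
    vanish. *)
Lemma parabola_corner v : is_corner (conv_hull (range pos)) (pos v).
Proof.
have hull_sub : conv_hull (range pos) `<=` [set p : R * R | p.1 ^+ 2 <= p.2].
  apply: smallest_sub; last by move=> _ [w _ <-] /=.
  apply/convex_setP => -[x1 x2] [y1 y2] t /= Hx Hy /andP[t0 t1].
  suff : 0 <= (1 - t) * (x2 - x1 ^+ 2) + t * (y2 - y1 ^+ 2)
           + t * (1 - t) * (x1 - y1) ^+ 2 by rewrite /GRing.scale /=; lra.
  have t1' : 0 <= 1 - t by rewrite subr_ge0.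
  apply: addr_ge0; last exact: mulr_ge0 (mulr_ge0 t0 t1') (sqr_ge0 _).
  by apply: addr_ge0; apply: mulr_ge0; rewrite ?subr_ge0.
split; first by apply: sub_gen_smallest; exists v.
move=> y z t /hull_sub + /hull_sub.
case: y z => [y1 y2] [z1 z2] /= Hy Hz /andP[t0 t1] [].
rewrite /GRing.scale /=; set x := (f v)%:R => E1 E2.
have t1' : 0 < 1 - t by rewrite subr_gt0.
have S : (1 - t) * (y2 - y1 ^+ 2) + t * (z2 - z1 ^+ 2)
           + t * (1 - t) * (y1 - z1) ^+ 2 = 0 by rewrite E1 in E2; lra.
have P1 : 0 <= (1 - t) * (y2 - y1 ^+ 2) by rewrite mulr_ge0 ?subr_ge0 // ltW.
have P2 : 0 <= t * (z2 - z1 ^+ 2) by rewrite mulr_ge0 ?subr_ge0 // ltW.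
have P3 : 0 <= t * (1 - t) * (y1 - z1) ^+ 2.
  by apply: mulr_ge0 (sqr_ge0 _); rewrite mulr_ge0 // ltW.
have /eqP : (1 - t) * (y2 - y1 ^+ 2) = 0 by lra.
rewrite mulf_eq0 (gt_eqF t1') subr_eq0 /= => /eqP ->.
have /eqP : t * (z2 - z1 ^+ 2) = 0 by lra.
rewrite mulf_eq0 (gt_eqF t0) subr_eq0 /= => /eqP ->.
have /eqP : t * (1 - t) * (y1 - z1) ^+ 2 = 0 by lra.
rewrite mulf_eq0 mulf_eq0 (gt_eqF t0) (gt_eqF t1') sqrf_eq0 subr_eq0 /= => /eqP yz.
by rewrite yz in E1 *; have -> : z1 = x by lra.
Qed.

(** The chord at parameter [t] lies [t (1 - t) (f u - f v)^2] above the parabola. *)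
Lemma parabola_collinear u v w :
  f u != f v -> segment (pos u) (pos v) (pos w) -> w = u \/ w = v.
Proof.
move=> uv /segmentP [t [_ /= E1 E2]].
have /eqP : ((f w)%:R - (f u)%:R) * ((f w)%:R - (f v)%:R) = 0 :> R.
  have : t * (1 - t) * ((f u)%:R - (f v)%:R) ^+ 2 = 0 :> R by rewrite E1 in E2; lra.
  rewrite E1; lra.
by rewrite mulf_eq0 !subr_eq0 !eqr_nat => /orP[] /eqP /f_inj; [left|right].
Qed.

(* The chords crossing the vertical line just to the right of [pos a] start either
   at [a], hence end beyond [b] and pass above [a b], or left of [a], hence stay at
   a positive distance above [pos a]. *)
Lemma parabola_ray_avoids a b (n : nat) :
  e a b -> (f a < f b < n)%N -> forall r : R,
  r <= (f a)%:R ^+ 2 + n.+1%:R^-1 * ((f a)%:R + (f b)%:R) ->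
  ~ drawing (compl_graph e) pos ((f a)%:R + n.+1%:R^-1, r).
Proof.
move=> ab /andP[lt_ab lt_bn] r r_le.
(* As [f b < n], this horizontal shift keeps [h * f b] below 1, as is needed for chords that start
   left of [a]. *)
set h := n.+1%:R^-1 in r_le *.
have h0 : 0 < h by rewrite invr_gt0 ltr0n.
have hb : h * (f b)%:R < 1.
  by rewrite mulrC ltr_pdivrMr ?ltr0n // mul1r ltr_nat; lia.
have fb1 : 1 <= (f b)%:R :> R by rewrite -[1]/(1%:R) ler_nat; lia.
have fa0 : 0 <= (f a)%:R :> R by [].
have h1 : h < 1 by nra.
have far (c d : V) : compl_graph e c d -> (f c < f d)%N ->
    ~ segment (pos c) (pos d) ((f a)%:R + h, r).
  move=> /andP[_ ncd] cd /segmentP[t [/andP[t0 t1] /= E1 E2]].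
  have lt_cd : (f c)%:R < (f d)%:R :> R by rewrite ltr_nat.
  have c_lt : (f c)%:R <= (f a)%:R + h by nra.
  have d_gt : (f a)%:R + h <= (f d)%:R by nra.
  have ca : (f c <= f a)%N.
    rewrite leqNgt; apply/negP; rewrite -(ltr_nat R) => ac.
    have : (f a).+1%:R <= (f c)%:R :> R by rewrite ler_nat -(ltr_nat R).
    by rewrite -natr1; lra.
  have ad : (f a < f d)%N by rewrite -(ltr_nat R); lra.
  have ad1 : (f a)%:R + 1 <= (f d)%:R :> R by rewrite natr1 ler_nat.
  (* At abscissa [x], the chord between the abscissas [c] and [d] has height
     [x^2 + (x - c) (d - x)]. *)
  have chord : r = ((f a)%:R + h) ^+ 2 +
      ((f a)%:R + h - (f c)%:R) * ((f d)%:R - (f a)%:R - h).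
    have hE : h = (1 - t) * (f c)%:R + t * (f d)%:R - (f a)%:R by lra.
    by rewrite E2 hE; ring.
  move: ca; rewrite leq_eqVlt => /orP[/eqP /f_inj E|ca].
    subst c.
    (* [d] is not a tree neighbour of [a]: so it is not [b], and [f_block] forbids the places
       between [a] and [b]. *)
    have bd : (f b < f d)%N.
      rewrite ltn_neqAle leqNgt; apply/andP; split.
        by apply: contra ncd => /eqP /f_inj <-.
      by apply: contra ncd => db; apply: (f_block ab); rewrite ad.
    have : (f b)%:R < (f d)%:R :> R by rewrite ltr_nat.
    nra.
  have ca1 : (f c)%:R + 1 <= (f a)%:R :> R by rewrite natr1 ler_nat.
  (* The chord is at least [1 - h^2] above the parabola, the ray at most [h (f b - f a - h)], and
     [h * f b < 1]. *)
  have : (1 + h) * (1 - h) <= ((f a)%:R + h - (f c)%:R) * ((f d)%:R - (f a)%:R - h).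
    by apply: ler_pM; lra.
  nra.
case=> [[w _ [/= E _]]|[c [d [cd]]]].
  have lt_aw : (f a < f w)%N by rewrite -(ltr_nat R) E; lra.
  have : (f a)%:R + 1 <= (f w)%:R :> R by rewrite natr1 ler_nat.
  by rewrite E; lra.
have [lt|lt|/f_inj Ecd] := ltngtP (f c) (f d); first exact: far.
  move=> /segment_sym; apply: far => //.
  by move: cd; rewrite /compl_graph eq_sym e_sym.
by move: cd; rewrite /compl_graph Ecd eqxx.
Qed.

Lemma parabola_OOR : has_convex_OOR R (compl_graph e).
Proof.
exists pos; split; last exact: parabola_corner.
split.
- by move=> u v [/eqP]; rewrite eqr_nat => /eqP /f_inj.
- move=> u v w /andP[uv _]; apply: parabola_collinear.
  by apply: contra uv => /eqP /f_inj ->.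
move=> u v uv; rewrite /compl_graph uv negbK => euv.
wlog lt_uv : u v uv euv / (f u < f v)%N.
  move=> H; have [lt|lt|/f_inj E] := ltngtP (f u) (f v); first exact: H.
    have [||z [uvz Oz]] := H v u _ _ lt; [by rewrite eq_sym|by rewrite e_sym|].
    by exists z; split=> //; apply: segment_sym.
  by rewrite E eqxx in uv.
pose n := (f v).+1; pose h : R := n.+1%:R^-1.
have lt_n : (f u < f v < n)%N by rewrite lt_uv ltnSn.
have avoid := parabola_ray_avoids euv lt_n; rewrite -/h in avoid.
have d_gt0 : 0 < (f v)%:R - (f u)%:R :> R by rewrite subr_gt0 ltr_nat.
pose b : R := (f u)%:R ^+ 2 + h * ((f u)%:R + (f v)%:R); rewrite -/b in avoid.
exists ((f u)%:R + h, b); split.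
  (* The parameter at which the chord reaches abscissa [f u + h]; its height there is [b]. *)
  apply/segmentP; exists (h / ((f v)%:R - (f u)%:R)); split=> /=.
  - apply/andP; split.
      by rewrite divr_ge0 ?(ltW d_gt0) // invr_ge0 ler0n.
    rewrite ler_pdivrMr // mul1r.
    have : (f u)%:R + 1 <= (f v)%:R :> R by rewrite natr1 ler_nat.
    have : h <= 1 by rewrite invf_le1 ?ltr0n // ler1n.
    lra.
  - by field; rewrite gt_eqF.
  - by rewrite /b; field; rewrite gt_eqF.
split; first exact: avoid.
apply: (@vertical_ray_unbounded _ ((f u)%:R + h) b) => r rb.
exists [set p : R * R | p.1 = (f u)%:R + h /\ p.2 <= b] => //=.
split=> //=; last exact: vertical_ray_connected.
by case=> p1 p2 /= [-> /avoid].
Qed.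

End Parabola.

(** * Orientations and enclosing polygons *)

Section Orientation.
Variable R : realType.
Implicit Types (a b c p u w x y z : R * R) (D : set (R * R)).

(** Twice the signed area of the triangle, positive when [a], [b], [c] turn counterclockwise. *)
Definition orient a b c : R :=
  (b.1 - a.1) * (c.2 - a.2) - (b.2 - a.2) * (c.1 - a.1).

Definition pt_on a b (t : R) : R * R := (1 - t) *: a + t *: b.

Lemma pt_on1 a b t : (pt_on a b t).1 = (1 - t) * a.1 + t * b.1.
Proof. by case: a b => [? ?] [? ?]. Qed.

Lemma pt_on2 a b t : (pt_on a b t).2 = (1 - t) * a.2 + t * b.2.
Proof. by case: a b => [? ?] [? ?]. Qed.

Lemma pt_on_end0 x y : pt_on x y 0 = x.
Proof. by rewrite /pt_on subr0 scale1r scale0r addr0. Qed.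

Lemma pt_on_end1 x y : pt_on x y 1 = y.
Proof. by rewrite /pt_on subrr scale1r scale0r add0r. Qed.

Lemma orient_cycle a b c : orient a b c = orient b c a.
Proof. rewrite /orient; ring. Qed.

Lemma orient_swap a b c : orient b a c = - orient a b c.
Proof. rewrite /orient; ring. Qed.

Lemma orient_swapr a b c : orient a c b = - orient a b c.
Proof. rewrite /orient; ring. Qed.

Lemma orient_left a b : orient a b a = 0.
Proof. rewrite /orient; ring. Qed.

Lemma orient_right a b : orient a b b = 0.
Proof. rewrite /orient; ring. Qed.

Lemma orient_pt_on a b x y t :
  orient a b (pt_on x y t) = (1 - t) * orient a b x + t * orient a b y.
Proof. rewrite /orient pt_on1 pt_on2; ring. Qed.

Lemma orient0_pt_on a b p : a != b -> orient a b p = 0 -> exists t, p = pt_on a b t.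
Proof.
case: a b p => [a1 a2] [b1 b2] [p1 p2]; rewrite /orient /= => ab E.
have [E1|N1] := eqVneq a1 b1.
  have N2 : b2 - a2 != 0.
    by rewrite subr_eq0; apply: contraNneq ab => ->; rewrite E1.
  exists ((p2 - a2) / (b2 - a2)).
  have Ep : p1 = a1.
    have /eqP : (b2 - a2) * (p1 - a1) = 0 by rewrite E1 in E *; lra.
    by rewrite mulf_eq0 (negbTE N2) subr_eq0 => /eqP.
  by rewrite [LHS]surjective_pairing [RHS]surjective_pairing pt_on1 pt_on2 /=;
    congr pair; rewrite ?Ep ?E1; field.
have N2 : b1 - a1 != 0 by rewrite subr_eq0 eq_sym.
exists ((p1 - a1) / (b1 - a1)).
rewrite [LHS]surjective_pairing [RHS]surjective_pairing pt_on1 pt_on2 /=.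
congr pair; first by field.
have -> : p2 = a2 + (b2 - a2) * (p1 - a1) / (b1 - a1).
  by apply: (mulfI N2); rewrite mulrDr mulrCA mulfV // mulr1; lra.
by field.
Qed.

Lemma orient_gt0_neq a b c : 0 < orient a b c -> a != b.
Proof.
by apply: contraTneq => ->; rewrite orient_cycle orient_left ltxx.
Qed.

Lemma segment_pt_on x y z : segment x y z <-> exists2 t, 0 <= t <= 1 & z = pt_on x y t.
Proof.
split=> [/segmentP[t [t01 z1 z2]]|[t t01 ->]].
  by exists t => //; rewrite [LHS]surjective_pairing z1 z2 -pt_on1 -pt_on2
    -surjective_pairing.
by apply/segmentP; exists t; rewrite pt_on1 pt_on2.
Qed.

Lemma orient_continuous a b : continuous (orient a b).
Proof.
move=> p; rewrite /orient; apply: cvgB; apply: cvgM; try exact: cvg_cst;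
  apply: cvgB; try exact: cvg_cst.
- exact: cvg_snd.
- exact: cvg_fst.
Qed.

(** On the line through [b] and [w], the side condition at [a b] bounds the parameter of [p] below
    by 0 and the one at [w u] bounds it above by 1. *)
Lemma segment_of_orient a b w u p :
  orient b w p = 0 -> 0 < orient a b w -> 0 <= orient a b p ->
  0 < orient w u b -> 0 <= orient w u p -> segment b w p.
Proof.
move=> bwp abw abp wub wup.
have bw : b != w by apply: (@orient_gt0_neq b w a); rewrite -orient_cycle.
have [t Ep] := orient0_pt_on bw bwp; apply/segment_pt_on; exists t => //.
move: abp wup; rewrite Ep !orient_pt_on orient_right orient_left.
rewrite !mulr0 addr0 add0r pmulr_lge0 // pmulr_lge0 // subr_ge0.
by move=> -> ->.
Qed.

(** The three orientations are, up to the factor [orient a b c], the barycentric coordinates of [p];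
    the norm is the maximum norm, so each coordinate is averaged separately. *)
Lemma triangle_bound a b c p (M : R) :
  0 <= orient a b p -> 0 <= orient b c p -> 0 <= orient c a p ->
  0 < orient a b c -> `|a| <= M -> `|b| <= M -> `|c| <= M -> `|p| <= M.
Proof.
set n1 := orient a b p; set n2 := orient b c p; set n3 := orient c a p.
move=> n1_ge0 n2_ge0 n3_ge0 d_gt0.
have dE : orient a b c = n2 + n3 + n1 by rewrite /n1 /n2 /n3 /orient; ring.
have p1E : orient a b c * p.1 = n2 * a.1 + n3 * b.1 + n1 * c.1.
  by rewrite /n1 /n2 /n3 /orient; ring.
have p2E : orient a b c * p.2 = n2 * a.2 + n3 * b.2 + n1 * c.2.
  by rewrite /n1 /n2 /n3 /orient; ring.
clearbody n1 n2 n3.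
have avg (r r1 r2 r3 : R) : orient a b c * r = n2 * r1 + n3 * r2 + n1 * r3 ->
    `|r1| <= M -> `|r2| <= M -> `|r3| <= M -> `|r| <= M.
  move=> E rM1 rM2 rM3; rewrite -(ler_pM2l d_gt0) -[X in X * `|r|]gtr0_norm //.
  rewrite -normrM E dE !mulrDl.
  apply: (le_trans (ler_normD _ _)); apply: lerD; last first.
    by rewrite normrM ger0_norm // ler_wpM2l.
  apply: (le_trans (ler_normD _ _)).
  by apply: lerD; rewrite normrM ger0_norm // ler_wpM2l.
rewrite !prod_normE /= !ge_max.
move=> /andP[a1 a2] /andP[b1 b2] /andP[c1 c2]; apply/andP; split.
  exact: avg p1E a1 b1 c1.
exact: avg p2E a2 b2 c2.
Qed.

(* Together with [a b], the zero set of [m] encloses a bounded region to the left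
   of [a b], whose boundary lies in [D] except for the interior of [a b]. *)
Definition barrier D a b := exists m : R * R -> R,
  [/\ continuous m,
      bounded_set [set p | 0 <= orient a b p /\ 0 <= m p],
      forall p, 0 <= orient a b p -> m p = 0 -> D p &
      forall t, (0 < m (pt_on a b t)) = (0 < t < 1)].

Lemma min_eq0 (r s : R) :
  Num.min r s = 0 -> [/\ 0 <= r, 0 <= s & r = 0 \/ s = 0].
Proof.
move=> E; have : 0 <= Num.min r s by rewrite E.
rewrite le_min => /andP[r0 s0]; split=> //.
by move: E; rewrite minEle; case: ifP => _; [left|right].
Qed.

Lemma bounded_setS_ball (A : set (R * R)) (M : R) :
  (forall p, A p -> `|p| <= M) -> bounded_set A.
Proof.
move=> AM; exists M; split=> [|r Mr p Ap]; first exact: num_real.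
by apply: le_trans (AM _ Ap) _; apply: ltW.
Qed.

Lemma barrier_triangle D a b c :
  0 < orient a b c -> segment b c `<=` D -> segment c a `<=` D -> barrier D a b.
Proof.
move=> abc Dbc Dca; have bca : 0 < orient b c a by rewrite -orient_cycle.
have cab : 0 < orient c a b by rewrite -orient_cycle.
exists (orient b c \min orient c a); split.
- by move=> p; apply: continuous_min; exact: orient_continuous.
- apply: (@bounded_setS_ball _ (`|a| + `|b| + `|c|)) => p /= [abp].
  rewrite le_min => /andP[bcp cap].
  apply: (triangle_bound abp bcp cap abc);
    by have := normr_ge0 a; have := normr_ge0 b; have := normr_ge0 c; lra.
- move=> p abp /= /min_eq0[bcp cap [E|E]].
    exact/Dbc/(segment_of_orient E abc abp cab cap).
  exact/Dca/(segment_of_orient E bca bcp abc abp).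
- move=> t /=; rewrite lt_min !orient_pt_on orient_left orient_right !mulr0 add0r addr0.
  by rewrite pmulr_lgt0 // pmulr_lgt0 // subr_gt0 andbC.
Qed.

Lemma barrier_quad D a b w u :
  0 < orient a b w -> 0 < orient a b u -> 0 < orient a w u -> 0 < orient b w u ->
  segment b w `<=` D -> segment w u `<=` D -> segment u a `<=` D -> barrier D a b.
Proof.
move=> abw abu awu bwu Dbw Dwu Dua.
have bwa : 0 < orient b w a by rewrite -orient_cycle.
have wua : 0 < orient w u a by rewrite -orient_cycle.
have wub : 0 < orient w u b by rewrite -orient_cycle.
have uaw : 0 < orient u a w by rewrite -orient_cycle.
have uab : 0 < orient u a b by rewrite orient_cycle.
exists (orient b w \min (orient w u \min orient u a)); split.
- by move=> p; do !apply: continuous_min; exact: orient_continuous.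
- apply: (@bounded_setS_ball _ (`|a| + `|b| + `|w| + `|u|)) => p /= [abp].
  rewrite !le_min => /and3P[bwp wup uap].
  (* The diagonal [a w] cuts the quadrilateral into two triangles, and [p] is bounded by the one on
     its side. *)
  have := normr_ge0 a; have := normr_ge0 b; have := normr_ge0 w; have := normr_ge0 u.
  move=> ? ? ? ?; case: (lerP 0 (orient a w p)) => awp.
    by apply: (triangle_bound awp wup uap awu); lra.
  have wap : 0 <= orient w a p by rewrite orient_swap oppr_ge0 ltW.
  by apply: (triangle_bound abp bwp wap abw); lra.
- move=> p abp /= /min_eq0[bwp /[dup] wuap + [E|/min_eq0]].
    rewrite le_min => /andP[wup uap].
    exact/Dbw/(segment_of_orient E abw abp wub wup).
  move=> _ [wup uap [E|E]].
    exact/Dwu/(segment_of_orient E bwu bwp uaw uap).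
  exact/Dua/(segment_of_orient E wua wup abu abp).
- move=> t /=; rewrite !lt_min !orient_pt_on orient_left orient_right !mulr0 add0r addr0.
  rewrite pmulr_lgt0 // pmulr_lgt0 // subr_gt0.
  by apply/and3P/andP => [[-> _ ->]//|[t0 t1]]; split=> //; nra.
Qed.

(** The two barrier regions, glued along [a b], form an open set [U] and a closed set [K] that
    differ only in points of [D]. So [U] is relatively clopen in the component, which therefore lies
    in it. *)
Lemma bounded_component D a b t :
  a != b -> barrier D a b -> barrier D b a -> 0 < t < 1 -> ~ D (pt_on a b t) ->
  bounded_set (connected_component (~` D) (pt_on a b t)).
Proof.
move=> ab [m1 [c1 bd1 D1 l1]] [m2 [c2 bd2 D2 l2]] t01 nD.
set x := pt_on a b t in nD *; set A := connected_component _ x.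
pose F := orient a b.
have FN p : orient b a p = - F p by rewrite orient_swap.
(* On the line through [a] and [b] both barriers are positive exactly inside [a b]; this makes the
   glued set [U] open there. *)
have line p : F p = 0 -> (0 < m1 p) = (0 < m2 p).
  move=> /(orient0_pt_on ab)[s ->]; rewrite l1.
  have -> : pt_on a b s = pt_on b a (1 - s) by rewrite /pt_on subKr addrC.
  by rewrite l2 subr_gt0 gtrBl andbC.
pose U := [set p | 0 <= F p /\ 0 < m1 p] `|` [set p | F p <= 0 /\ 0 < m2 p].
pose K := [set p | 0 <= F p /\ 0 <= m1 p] `|` [set p | F p <= 0 /\ 0 <= m2 p].
have cl (h : R * R -> R) : continuous h -> closed [set p | 0 <= h p].
  move=> ch; apply: (@closed_comp _ _ h [set r | 0 <= r]); last exact: closed_ge.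
  by move=> p _; exact: ch.
have cl' (h : R * R -> R) : continuous h -> closed [set p | h p <= 0].
  move=> ch; apply: (@closed_comp _ _ h [set r | r <= 0]); last exact: closed_le.
  by move=> p _; exact: ch.
have cF := @orient_continuous a b.
have Kcl : closed K.
  by apply: closedU; [exact: closedI (cl _ cF) (cl _ c1)|
    exact: closedI (cl' _ cF) (cl _ c2)].
have Uop : open U.
  rewrite -[U]setCK openC.
  suff -> : ~` U = ([set p | 0 <= F p] `&` [set p | m1 p <= 0])
      `|` ([set p | F p <= 0] `&` [set p | m2 p <= 0]).
    by apply: closedU; [exact: closedI (cl _ cF) (cl' _ c1)|
      exact: closedI (cl' _ cF) (cl' _ c2)].
  apply/seteqP; split=> p /=.
    move=> /not_orP[/not_andP n1 /not_andP n2].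
    case: (lerP 0 (F p)) n1 n2 => [F0 [//|/negP] n1|F0 _ [|/negP]].
    - by left; rewrite leNgt.
    - by rewrite ltW.
    - by right; rewrite ltW // leNgt.
  case=> [[F0 m0] [[_]|[F0' m2p]]|[F0 m0] [[F0' m1p]|[_]]].
  - by rewrite ltNge m0.
  - have /line : F p = 0 by apply/eqP; rewrite eq_le F0 F0'.
    by rewrite m2p ltNge m0.
  - have /line : F p = 0 by apply/eqP; rewrite eq_le F0 F0'.
    by rewrite m1p ltNge m0.
  - by rewrite ltNge m0.
have AD p : A p -> ~ D p by move=> /connected_component_sub.
have AUK : A `&` U = A `&` K.
  apply/seteqP; split=> p [Ap].
    by case=> -[F0 /ltW m0]; split=> //; [left|right].
  case=> -[F0 m0]; split=> //; [left|right]; split=> //; rewrite lt_neqAle m0 andbT.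
    by apply/negP => /eqP E; apply: (AD p Ap); apply: D1.
  by apply/negP => /eqP E; apply: (AD p Ap); apply: D2; rewrite ?FN ?oppr_ge0.
have Ax : A x by exact: connected_component_refl.
have AU : A `&` U = A.
  apply: (@component_connected _ (~` D) x (A `&` U)).
  - exists x; split=> //; left; split; last by rewrite l1.
    by rewrite /F orient_pt_on orient_left orient_right !mulr0 addr0.
  - by exists U.
  - by exists K.
have [M1 [_ bd1']] := bd1; have [M2 [_ bd2']] := bd2.
pose M := Num.max M1 M2 + 1.
apply: (@bounded_setS_ball _ M) => p; rewrite -/A -AU => -[_ [[F0 /ltW m0]|[F0 /ltW m0]]].
  apply: (bd1' M) => //; rewrite /M.
  have : M1 <= Num.max M1 M2 by rewrite le_max lexx.
  lra.
have M2M : M2 < M.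
  have : M2 <= Num.max M1 M2 by rewrite le_max lexx orbT.
  rewrite /M; lra.
apply: (bd2' M) => //.
by split; rewrite // FN oppr_ge0.
Qed.

End Orientation.

Lemma segment_sub (R : realType) (x y z : R * R) :
  segment x y z -> segment x z `<=` segment x y.
Proof.
move=> /segment_pt_on[t /andP[t0 t1] ->] q /segment_pt_on[s /andP[s0 s1] ->].
apply/segment_pt_on; exists (s * t).
  by rewrite mulr_ge0 //= mulr_ile1.
rewrite [LHS]surjective_pairing [RHS]surjective_pairing !(pt_on1, pt_on2).
by congr pair; ring.
Qed.

Lemma barrier_crossing (R : realType) (D : set (R * R)) a b u w :
  0 < orient a b u -> 0 < orient a b w -> 0 < orient a u w -> 0 < orient b u w ->
  segment a u `<=` D -> segment b w `<=` D -> barrier D a b.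
Proof.
move=> abu abw auw buw Dau Dbw.
have bwa : 0 < orient b w a by rewrite -orient_cycle.
have wab : 0 < orient w a b by rewrite orient_cycle.
have bwu : orient b w u = - orient b u w by rewrite /orient; ring.
pose d := orient b w a + orient b u w.
have d0 : 0 < d by rewrite addr_gt0.
(* [X] is the crossing of [a u] and [b w]: [s] solves the affine equation [orient b w X = 0]. The
   triangle [a b X] is the barrier. *)
pose s := orient b w a / d; pose X := pt_on a u s.
have s0 : 0 < s by rewrite divr_gt0.
have s1 : s <= 1 by rewrite ler_pdivrMr // mul1r lerDl ltW.
have auX : segment a u X by apply/segment_pt_on; exists s; rewrite // (ltW s0).
have bwX0 : orient b w X = 0.
  by rewrite orient_pt_on bwu /s /d; field; rewrite gt_eqF.
have abX : 0 < orient a b X.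
  by rewrite orient_pt_on orient_left mulr0 add0r mulr_gt0.
have waX : 0 <= orient w a X.
  by rewrite orient_pt_on orient_right mulr0 add0r orient_cycle mulr_ge0 ?ltW.
have bwX := segment_of_orient bwX0 abw (ltW abX) wab waX.
apply: (barrier_triangle abX).
  exact: subset_trans (segment_sub bwX) Dbw.
exact: subset_trans (@segment_sym _ _ _) (subset_trans (segment_sub auX) Dau).
Qed.

(** * Vertices in convex position *)

Section ConvexPosition.
Variables (R : realType) (V : finType) (pos : V -> R * R).
Hypotheses (pos_inj : injective pos) (pos_convex : convex_position pos).
Implicit Types a b c o u v w : V.

Local Notation ort a b c := (orient (pos a) (pos b) (pos c)).

Let hull_pos v : conv_hull (range pos) (pos v).
Proof. by apply: sub_gen_smallest; exists v. Qed.

Lemma corner_not_between u v w (t : R) :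
  0 < t < 1 -> pos w = pt_on (pos u) (pos v) t -> u = w.
Proof.
move=> t01 E; have [_ /(_ _ _ t (hull_pos u) (hull_pos v) t01 E) [+ _]] := pos_convex w.
exact: pos_inj.
Qed.

Lemma orient_neq0 u v w : u != v -> v != w -> w != u -> ort u v w != 0.
Proof.
move=> uv vw wu; apply/eqP => E.
have [|s Es] := orient0_pt_on _ E; first by rewrite (inj_eq pos_inj).
have pairE (p q : R * R) : p.1 = q.1 -> p.2 = q.2 -> p = q.
  by case: p q => [? ?] [? ?] /= -> ->.
have Es1 := congr1 fst Es; have Es2 := congr1 snd Es.
rewrite pt_on1 in Es1; rewrite pt_on2 in Es2.
(* Of three collinear points one is strictly between the others: [u] if [s < 0], [w] if [0 < s < 1],
   [v] if [s > 1]. *)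
have [s0|s0|s0] := ltgtP s 0.
- have d0 : 0 < 1 - s by lra.
  have /corner_not_between E' : 0 < - s / (1 - s) < 1.
    by rewrite divr_gt0 ?oppr_gt0 //= ltr_pdivrMr // mul1r; lra.
  move: wu; rewrite (E' w v u) ?eqxx //.
  by apply: pairE; rewrite ?pt_on1 ?pt_on2 ?Es1 ?Es2; field; rewrite gt_eqF.
- have [s1|s1|s1] := ltgtP s 1.
  + have /corner_not_between E' : 0 < s < 1 by rewrite s0.
    by move: wu; rewrite (E' u v w) ?eqxx.
  + have /corner_not_between E' : 0 < s^-1 < 1.
      by rewrite invr_gt0 s0 invf_lt1.
    move: uv; rewrite (E' u w v) ?eqxx //.
    by apply: pairE; rewrite ?pt_on1 ?pt_on2 ?Es1 ?Es2; field; rewrite gt_eqF.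
  + move: vw; rewrite -(inj_eq pos_inj) => /eqP; apply.
    by apply: pairE; rewrite ?Es1 ?Es2 s1; ring.
- move: wu; rewrite -(inj_eq pos_inj) => /eqP; apply.
  by apply: pairE; rewrite ?Es1 ?Es2 s0; ring.
Qed.

Lemma orient_gt0_swap u v w : u != v -> v != w -> w != u ->
  (0 < ort u v w) = ~~ (0 < ort v u w).
Proof.
move=> uv vw wu; have := orient_neq0 uv vw wu.
rewrite (orient_swap (pos u)) oppr_gt0 -leNgt le_eqVlt eq_sym => /negbTE -> //.
Qed.

Lemma orient_gt0_swapr u v w : u != v -> v != w -> w != u ->
  (0 < ort u v w) = ~~ (0 < ort u w v).
Proof.
by move=> uv vw wu; rewrite orient_gt0_swap // orient_cycle.
Qed.

(** Otherwise [o] would be interior to the triangle [a b c], hence strictly between [c] and a point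
    of [a b], and no corner. *)
Lemma not_in_triangle o a b c :
  0 < ort o a b -> 0 < ort o b c -> ~~ (0 < ort o c a).
Proof.
move=> oab obc; apply/negP => oca.
set x := ort o a b in oab; set y := ort o b c in obc; set z := ort o c a in oca.
have yco : c = o -> y = 0 by rewrite /y => ->; rewrite orient_left.
have S1 : (x + y + z) * (pos o).1 = y * (pos a).1 + z * (pos b).1 + x * (pos c).1.
  by rewrite /x /y /z /orient; ring.
have S2 : (x + y + z) * (pos o).2 = y * (pos a).2 + z * (pos b).2 + x * (pos c).2.
  by rewrite /x /y /z /orient; ring.
clearbody x y z.
have yz_gt0 : 0 < y + z by rewrite addr_gt0.
have xyz_gt0 : 0 < x + y + z by rewrite -addrA addr_gt0.
pose t := x / (x + y + z); pose s := z / (y + z).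
have t01 : 0 < t < 1.
  by rewrite /t divr_gt0 //= ltr_pdivrMr // mul1r; lra.
have s01 : 0 <= s <= 1.
  by rewrite /s (ltW (divr_gt0 _ _)) //= ler_pdivrMr // mul1r; lra.
have hull_ab : conv_hull (range pos) (pt_on (pos a) (pos b) s) by exact: conv_hull_convex.
have [_ H] := pos_convex o.
have [|_ /pos_inj /yco y0] := H _ _ t hull_ab (hull_pos c) t01; last first.
- by rewrite y0 ltxx in obc.
rewrite -/(pt_on _ _ _) [LHS]surjective_pairing [RHS]surjective_pairing !(pt_on1, pt_on2).
have xyz : x + y + z != 0 by rewrite gt_eqF.
have yz : y + z != 0 by rewrite gt_eqF.
by congr pair; apply: (mulfI xyz); rewrite ?S1 ?S2 /t /s; field; rewrite ?xyz ?yz.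
Qed.

Variable e : rel V.
Hypotheses (e_sym : symmetric e) (e_irr : irreflexive e) (e_acyclic : acyclic_graph e).

Let D := drawing (compl_graph e) pos.

Let compl_drawn u v : u != v -> ~~ e u v -> segment (pos u) (pos v) `<=` D.
Proof. by move=> uv nuv z uvz; right; exists u, v; rewrite /compl_graph uv nuv. Qed.

(* If [a u] and [b w] are uncrossed edges of the complement then one of [u w],
   [a w], [b u] is one too, since [e] has no 4-cycle [a w u b]. *)
Lemma barrier_of_non_neighbours a b u w : e a b ->
  0 < ort a b u -> ~~ e a u -> 0 < ort a b w -> ~~ e b w ->
  barrier D (pos a) (pos b).
Proof.
move=> ab abu nau abw nbw.
have ne x y : ~~ e x y -> ~~ e y x by rewrite e_sym.
have nab : a != b by apply: contraTneq ab => ->; rewrite e_irr.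
have side_neq x : 0 < ort a b x -> a != x /\ b != x.
  by move=> abx; split; apply: contraTneq abx => <-; rewrite ?orient_left ?orient_right ltxx.
have [au bu] := side_neq u abu; have [aw bw] := side_neq w abw.
have tri c : 0 < ort a b c -> ~~ e a c -> ~~ e b c -> barrier D (pos a) (pos b).
  move=> abc nac nbc; have [nac' nbc'] := side_neq c abc.
  by apply: (barrier_triangle abc); apply: compl_drawn => //; rewrite 1?eq_sym // ne.
have [Euw|uw] := eqVneq u w; first by subst w; apply: (tri u).
have uab : 0 < ort u a b by rewrite orient_cycle.
have wab : 0 < ort w a b by rewrite orient_cycle.
(* If [a], [b], [u], [w] is the cyclic order, the drawn chords [a u] and [b w] cross; otherwise the
   order is [a], [b], [w], [u] and they are sides. *)
have [auw|] := boolP (0 < ort a u w).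
  have buw : 0 < ort b u w.
    rewrite orient_gt0_swap // 1?eq_sym //; apply/negP => ubw.
    by have := not_in_triangle uab ubw; rewrite -orient_cycle auw.
  by apply: (barrier_crossing abu abw auw buw); apply: compl_drawn.
rewrite orient_gt0_swap // 1?eq_sym // negbK => uaw.
have awu : 0 < ort a w u by rewrite -orient_cycle.
have [euw|nuw] := boolP (e u w).
  have [eaw|naw] := boolP (e a w); last exact: (tri w).
  have [ebu|nbu] := boolP (e b u); last exact: (tri u).
  have /negP[] : ~~ e b a; last by rewrite e_sym.
  by apply: (acyclic_no_square e_irr e_acyclic au _ eaw); rewrite // 1?eq_sym // e_sym.
have bwu : 0 < ort b w u.
  rewrite orient_gt0_swap // 1?eq_sym //; apply/negP => wbu.
  by have := not_in_triangle wab wbu; rewrite -orient_cycle awu.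
apply: (barrier_quad abw abu awu bwu); apply: compl_drawn => //.
- by rewrite eq_sym.
- exact: ne.
- by rewrite eq_sym.
- exact: ne.
Qed.

End ConvexPosition.

(** * Spiders *)

Definition cyclic_lt (a b c : nat) : bool :=
  [|| (a < b < c)%N, (b < c < a)%N | (c < a < b)%N].

Definition empty_arc (x y : nat) (s : seq nat) : bool :=
  all (fun z => ~~ cyclic_lt x y z) s || all (fun z => ~~ cyclic_lt y x z) s.

(** The analogue of [empty_arc] for a chord from the centre: the circular order starts there, so the
    two arcs consist of the ranks below and above [x]. *)
Definition extremal (x : nat) (s : seq nat) : bool :=
  all (fun z => ~~ (z < x)%N) s || all (fun z => ~~ (x < z)%N) s.

(* The ranks of the legs [x_i - y_i] of a spider in the circular order of its
   vertices that starts at the centre, together with what the fan property says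
   about the legs and about the edges at the centre. *)
Definition spider_order (x1 y1 x2 y2 x3 y3 : nat) : bool :=
  let ys := [:: y1; y2; y3] in
  [&& uniq [:: x1; y1; x2; y2; x3; y3],
    empty_arc x1 y1 [:: x2; y2; x3; y3], empty_arc x2 y2 [:: x1; y1; x3; y3],
    empty_arc x3 y3 [:: x1; y1; x2; y2],
    extremal x1 ys || extremal x1 [:: x2; y2; x3; y3],
    extremal x2 ys || extremal x2 [:: x1; y1; x3; y3] &
    extremal x3 ys || extremal x3 [:: x1; y1; x2; y2]].

Lemma no_spider_order (x1 y1 x2 y2 x3 y3 : nat) :
  all (fun z => z < 6)%N [:: x1; y1; x2; y2; x3; y3] ->
  ~~ spider_order x1 y1 x2 y2 x3 y3.
Proof.
move=> /and5P[x1s y1s x2s y2s /and3P[x3s y3s _]].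
pose I := iota 0 6.
have : all (fun a => all (fun b => all (fun c => all (fun d => all (fun e =>
  all (fun f => ~~ spider_order a b c d e f) I) I) I) I) I) I by vm_compute.
have mI z : (z < 6)%N -> z \in I by rewrite mem_iota.
move=> /allP/(_ _ (mI _ x1s))/allP/(_ _ (mI _ y1s))/allP/(_ _ (mI _ x2s)).
by move=> /allP/(_ _ (mI _ y2s))/allP/(_ _ (mI _ x3s))/allP/(_ _ (mI _ y3s)).
Qed.

(** * Spiders in convex position *)

Section SpiderInConvexPosition.
Variables (R : realType) (V : finType) (pos : V -> R * R).
Hypotheses (pos_inj : injective pos) (pos_convex : convex_position pos).
Implicit Types a b c o u v w : V.

Local Notation ort a b c := (orient (pos a) (pos b) (pos c)).

Section Rank.
Variables (o : V) (s : seq V).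
Hypothesis o_notin : o \notin s.

Let neq_o u : u \in s -> u != o.
Proof. by apply: contraTneq => ->. Qed.

(** Seen from the corner [o], the other vertices lie within an angle less than a half-turn, so
    orientation about [o] orders them linearly; this is the position of [v]. *)
Definition rank v := #|[pred u | (u \in s) && (0 < ort o u v)]|.

Lemma orient_trans u v w : u \in s -> v \in s -> w \in s ->
  0 < ort o u v -> 0 < ort o v w -> 0 < ort o u w.
Proof.
move=> us vs ws ouv ovw.
have nowu := not_in_triangle pos_inj pos_convex ouv ovw.
have [E|uw] := eqVneq u w.
  by subst w; move: ouv; rewrite orient_swapr oppr_gt0 ltNge (ltW ovw).
have ow : w != o := neq_o ws; have ou : o != u by rewrite eq_sym neq_o.
by rewrite (orient_gt0_swapr pos_inj pos_convex).
Qed.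

Lemma rank_lt u v : u \in s -> v \in s -> 0 < ort o u v -> (rank u < rank v)%N.
Proof.
move=> us vs ouv; apply: proper_card; apply/properP; split.
  apply/fintype.subsetP => x /andP[xs oxu]; rewrite unfold_in xs.
  exact: (orient_trans xs us vs).
exists u; first by rewrite unfold_in us.
by rewrite unfold_in orient_right ltxx andbF.
Qed.

Lemma rank_ltP u v : u \in s -> v \in s -> u != v ->
  (rank u < rank v)%N = (0 < ort o u v).
Proof.
move=> us vs uv; apply/idP/idP => [|/rank_lt -> //].
have ov := neq_o vs; have ou := neq_o us.
rewrite (orient_gt0_swapr pos_inj pos_convex) // 1?eq_sym //.
apply: contraTN => ovu.
by rewrite -leqNgt ltnW // rank_lt.
Qed.

Lemma rank_inj : {in s &, injective rank}.
Proof.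
move=> u v us vs E; apply/eqP; apply: contraT => uv.
have vu : v != u by rewrite eq_sym.
have := rank_ltP us vs uv; rewrite (orient_gt0_swapr pos_inj pos_convex) ?neq_o //.
  by rewrite -(rank_ltP vs us vu) E ltnn.
by rewrite eq_sym neq_o.
Qed.

Lemma rank_bound v : uniq s -> v \in s -> (rank v < size s)%N.
Proof.
move=> us vs; rewrite -(card_uniqP us); apply: proper_card; apply/properP; split.
  by apply/fintype.subsetP => x /andP[].
by exists v => //; rewrite unfold_in orient_right ltxx andbF.
Qed.

(** If ranks increase along [a], [b], [c] but the triple turns clockwise, [b] lies inside the
    triangle [o a c]. Rotating the triple gives the other cases. *)
Lemma orient_of_cyclic_lt u v w : u \in s -> v \in s -> w \in s ->
  cyclic_lt (rank u) (rank v) (rank w) -> 0 < ort u v w.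
Proof.
have main a b c : a \in s -> b \in s -> c \in s ->
    (rank a < rank b < rank c)%N -> 0 < ort a b c.
  move=> as_ bs cs /andP[lt_ab lt_bc].
  have ab : a != b by apply: contraTneq lt_ab => ->; rewrite ltnn.
  have bc : b != c by apply: contraTneq lt_bc => ->; rewrite ltnn.
  have ca : c != a by apply: contraTneq (ltn_trans lt_ab lt_bc) => ->; rewrite ltnn.
  rewrite (orient_gt0_swap pos_inj pos_convex) //; apply/negP => bac.
  have boa : 0 < ort b o a by rewrite orient_cycle -rank_ltP.
  have := not_in_triangle pos_inj pos_convex boa bac.
  by rewrite -orient_cycle -rank_ltP // lt_bc.
by move=> us vs ws /or3P[]; [|rewrite orient_cycle|rewrite -orient_cycle]; exact: main.
Qed.

End Rank.

Variable e : rel V.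
Hypotheses (e_sym : symmetric e) (e_irr : irreflexive e) (e_acyclic : acyclic_graph e).

(** A side without a fan has a barrier. Barriers on both sides would put every undrawn point of
    [a b] in a bounded component, against visibility. *)
Lemma outer_edge_fan a b : is_OOR (compl_graph e) pos -> e a b ->
  exists2 c, c \in [:: a; b] &
    (forall v, 0 < ort a b v -> e c v) \/ (forall v, 0 < ort b a v -> e c v).
Proof.
move=> [_ _ vis] ab.
pose D := drawing (compl_graph e) pos.
have nab : a != b by apply: contraTneq ab => ->; rewrite e_irr.
have side x y : e x y ->
    (exists2 c, c \in [:: x; y] & forall v, 0 < ort x y v -> e c v) \/
    barrier D (pos x) (pos y).
  move=> xy.
  have [/forallP H|/forallPn[u]] := boolP [forall v, (0 < ort x y v) ==> e x v].
    by left; exists x => [|v xyv]; [rewrite mem_head|have := H v; rewrite xyv].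
  have [/forallP H|/forallPn[w]] := boolP [forall v, (0 < ort x y v) ==> e y v].
    by left; exists y => [|v xyv]; [rewrite !in_cons eqxx orbT|have := H v; rewrite xyv].
  rewrite !negb_imply => /andP[xyw nyw] /andP[xyu nxu]; right.
  exact: (barrier_of_non_neighbours pos_inj pos_convex e_sym e_irr e_acyclic xy xyu nxu xyw nyw).
have [[c cab H]|barL] := side a b ab; first by exists c => //; left.
have [|[c cab H]|barR] := side b a; first by rewrite e_sym.
  by exists c; [move: cab; rewrite !in_cons !in_nil !orbF orbC|right].
have [|z [/segment_pt_on[t /andP[t0 t1] ->] [nD unb]]] := vis a b nab.
  by rewrite /compl_graph ab andbF.
exfalso; apply/unb/bounded_component => //; first by rewrite (inj_eq pos_inj).
have vD v : D (pos v) by left; exists v.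
rewrite !lt_neqAle t0 t1 !andbT; apply/andP; split; apply/eqP => E; apply: nD.
  by rewrite -E pt_on_end0; exact: vD.
by rewrite E pt_on_end1; exact: vD.
Qed.

Section Spider.
Hypothesis oor : is_OOR (compl_graph e) pos.
Variables (o : V) (s : seq V).
Hypothesis o_notin : o \notin s.

Local Notation rank := (rank o s).

(** The fan side of [x y] contains only neighbours of [x] or only neighbours of [y], hence nothing
    from [t]. *)
Lemma leg_empty_arc x y t : x \in s -> y \in s -> {subset t <= s} -> e x y ->
  all (fun z => ~~ e x z && ~~ e y z) t -> empty_arc (rank x) (rank y) (map rank t).
Proof.
move=> xs ys ts xy /allP far; have [c cxy fan] := outer_edge_fan oor xy.
have nc z : z \in t -> ~~ e c z.
  by move: cxy; rewrite !in_cons in_nil orbF => /orP[]/eqP-> /far/andP[].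
rewrite /empty_arc !all_map.
by case: fan => fan; apply/orP; [left|right]; apply/allP => z zt /=;
  apply: contra (nc z zt) => /(orient_of_cyclic_lt o_notin) H; apply/fan/H => //; exact: ts.
Qed.

(** The fan is centred at [o] or at [x]; its side is then free of [t] or of [t'], respectively. *)
Lemma hub_extremal x t t' : x \in s -> {subset t <= s} -> {subset t' <= s} -> e o x ->
  all (fun z => ~~ e o z) t -> all (fun z => ~~ e x z) t' ->
  extremal (rank x) (map rank t) || extremal (rank x) (map rank t').
Proof.
move=> xs ts t's ox /allP no /allP nx; have [c cox fan] := outer_edge_fan oor ox.
have main r : {subset r <= s} -> (forall z, z \in r -> ~~ e c z) ->
    extremal (rank x) (map rank r).
  move=> rs nc; rewrite /extremal !all_map.
  case: fan => fan; apply/orP; [right|left]; apply/allP => z zr /=;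
    apply: contra (nc z zr) => lt; apply: fan.
    rewrite -(rank_ltP o_notin) //; first exact: rs.
    by apply: contraTneq lt => ->; rewrite ltnn.
  rewrite orient_cycle -(rank_ltP o_notin) //; first exact: rs.
  by apply: contraTneq lt => ->; rewrite ltnn.
move: cox; rewrite !in_cons in_nil orbF => /orP[]/eqP Ec.
  by rewrite main // => z; rewrite Ec; exact: no.
by rewrite (main t') ?orbT // => z; rewrite Ec; exact: nx.
Qed.

End Spider.

(** The forbidden edges would close the triangle [o x x'], the square [o x y' x'] or the pentagon
    [o x y y' x']. *)
Lemma legs_apart o x y x' y' : [/\ e o x, e x y & y != o] ->
  [/\ e o x', e x' y' & y' != o] -> x != x' ->
  [/\ ~~ e x x', ~~ e x y', ~~ e y y', y != y' & x != y'].
Proof.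
move=> [ox xy yo] [ox' x'y' y'o] xx'.
have nz a b : e a b -> a != b by apply: contraTneq => ->; rewrite e_irr.
have nxx' : ~~ e x x'.
  by apply/negP => E; have := acyclic_no_triangle e_irr e_acyclic ox E; rewrite e_sym ox'.
have sq z : e x z -> e x' z -> z = o.
  move=> xz x'z; apply/eqP; apply: contraT => zo.
  have := acyclic_no_square (z := x') e_irr e_acyclic _ xx' ox xz.
  by rewrite eq_sym (e_sym z) (e_sym x' o) ox' => /(_ zo x'z).
have nxy' : ~~ e x y' by apply/negP => /sq/(_ x'y')/eqP; rewrite (negbTE y'o).
have yy' : y != y' by apply: contraNneq nxy' => <-.
have xy' : x != y' by apply: contraNneq nxx' => ->; rewrite e_sym.
have yx' : y != x' by apply: contraNneq nxx' => <-.
split=> //; apply/negP => E.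
have y'x' : e y' x' by rewrite e_sym.
have oy : o != y by rewrite eq_sym.
have oy' : o != y' by rewrite eq_sym.
have := @acyclic_no_chord _ _ e_acyclic o [:: x; y; y'; x'].
rewrite /= ox xy E y'x' e_sym ox' !in_cons !in_nil !orbF !negb_or.
rewrite oy oy' xx' xy' yy' yx' !nz // => H.
by have := H isT isT isT.
Qed.

Lemma no_outer_spider o x1 y1 x2 y2 x3 y3 : is_OOR (compl_graph e) pos ->
  [/\ e o x1, e x1 y1 & y1 != o] -> [/\ e o x2, e x2 y2 & y2 != o] ->
  [/\ e o x3, e x3 y3 & y3 != o] -> uniq [:: x1; x2; x3] -> False.
Proof.
move=> oor l1 l2 l3.
rewrite /= !in_cons !in_nil !orbF negb_or !andbT => /andP[/andP[x12 x13] x23].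
have x21 : x2 != x1 by rewrite eq_sym.
have x31 : x3 != x1 by rewrite eq_sym.
have x32 : x3 != x2 by rewrite eq_sym.
have [a12 b12 c12 d12 f12] := legs_apart l1 l2 x12.
have [a13 b13 c13 d13 f13] := legs_apart l1 l3 x13.
have [a21 b21 c21 d21 f21] := legs_apart l2 l1 x21.
have [a23 b23 c23 d23 f23] := legs_apart l2 l3 x23.
have [a31 b31 c31 d31 f31] := legs_apart l3 l1 x31.
have [a32 b32 c32 d32 f32] := legs_apart l3 l2 x32.
have leg x y : [/\ e o x, e x y & y != o] -> [/\ x != y, o != x, o != y & ~~ e o y].
  move=> [ox xy yo]; split; rewrite 1?eq_sym //.
  - by apply: contraTneq xy => ->; rewrite e_irr.
  - by apply: contraTneq ox => ->; rewrite e_irr.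
  - by rewrite e_sym (acyclic_no_triangle e_irr e_acyclic ox xy).
have [xy1 ox1 oy1 noy1] := leg _ _ l1; have [xy2 ox2 oy2 noy2] := leg _ _ l2.
have [xy3 ox3 oy3 noy3] := leg _ _ l3.
have [e1 g1 _] := l1; have [e2 g2 _] := l2; have [e3 g3 _] := l3.
pose s := [:: x1; y1; x2; y2; x3; y3].
have o_notin : o \notin s by rewrite !in_cons in_nil !negb_or ox1 oy1 ox2 oy2 ox3 oy3.
have us : uniq s.
  rewrite /s /= !in_cons !in_nil !negb_or xy1 x12 f12 x13 f13 xy2 x23 f23 xy3 d12 d13 d23.
  by rewrite !(eq_sym y1) !(eq_sym y2) f21 f31 f32.
have sub t : all (mem s) t -> {subset t <= s} by move/allP.
have mem z : all (mem s) [:: z] -> z \in s by rewrite /= andbT.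
have rk_lt : all (fun z => z < 6)%N (map (rank o s) s).
  by rewrite all_map; apply/allP => z zs /=; apply: (@rank_bound o s z us zs).
suff : spider_order (rank o s x1) (rank o s y1) (rank o s x2) (rank o s y2)
         (rank o s x3) (rank o s y3) by apply/negP; exact: no_spider_order.
have s_rk : uniq (map (rank o s) s) by rewrite map_inj_in_uniq //; exact: rank_inj.
have ms : [/\ x1 \in s, y1 \in s, x2 \in s, y2 \in s & x3 \in s /\ y3 \in s].
  by rewrite !in_cons !eqxx !orbT.
have [x1s y1s x2s y2s [x3s y3s]] := ms.
have arc := leg_empty_arc oor o_notin; have ext := hub_extremal oor o_notin.
have sy z1 z2 : ~~ e z1 z2 -> ~~ e z2 z1 by rewrite e_sym.
rewrite /spider_order; apply/and5P; split; first exact: s_rk.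
- by apply: (arc x1 y1 [:: x2; y2; x3; y3]) => //; [apply/sub|];
    rewrite /= ?x2s ?y2s ?x3s ?y3s // ?a12 ?b12 ?c12 ?a13 ?b13 ?c13 ?(sy _ _ b21) ?(sy _ _ b31).
- by apply: (arc x2 y2 [:: x1; y1; x3; y3]) => //; [apply/sub|];
    rewrite /= ?x1s ?y1s ?x3s ?y3s // ?a21 ?b21 ?c21 ?a23 ?b23 ?c23 ?(sy _ _ b12) ?(sy _ _ b32).
- by apply: (arc x3 y3 [:: x1; y1; x2; y2]) => //; [apply/sub|];
    rewrite /= ?x1s ?y1s ?x2s ?y2s // ?a31 ?b31 ?c31 ?a32 ?b32 ?c32 ?(sy _ _ b13) ?(sy _ _ b23).
have ys : all (fun z => ~~ e o z) [:: y1; y2; y3] by rewrite /= noy1 noy2 noy3.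
have yss : {subset [:: y1; y2; y3] <= s} by apply/sub; rewrite /= y1s y2s y3s.
apply/and3P; split.
- by apply: (ext x1 [:: y1; y2; y3] [:: x2; y2; x3; y3]) => //; [apply/sub|];
    rewrite /= ?x2s ?y2s ?x3s ?y3s // a12 b12 a13 b13.
- by apply: (ext x2 [:: y1; y2; y3] [:: x1; y1; x3; y3]) => //; [apply/sub|];
    rewrite /= ?x1s ?y1s ?x3s ?y3s // a21 b21 a23 b23.
- by apply: (ext x3 [:: y1; y2; y3] [:: x1; y1; x2; y2]) => //; [apply/sub|];
    rewrite /= ?x1s ?y1s ?x2s ?y2s // a31 b31 a32 b32.
Qed.

End SpiderInConvexPosition.

Theorem theorem5 (R : realType) (V : finType) (e : rel V)
    (e_sym : symmetric e) (e_irr : irreflexive e) (e_tree : is_tree e) :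
  has_convex_OOR R (compl_graph e) <-> is_caterpillar e.
Proof.
split=> [[pos [oor pos_convex]]|cat].
  have [pos_inj _ _] := oor; have [_ _ e_acyclic] := e_tree.
  apply: contrapT => /(spider_of_not_caterpillar e_sym e_irr e_tree).
  move=> [hub [x1 [y1 [x2 [y2 [x3 [y3 [l1 l2 l3 ux]]]]]]]].
  exact: (no_outer_spider pos_inj pos_convex e_sym e_irr e_acyclic oor l1 l2 l3 ux).
have [f [f_inj f_block]] := caterpillar_order e_sym e_irr cat.
exact: (parabola_OOR R e_sym f_inj f_block).
Qed.
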